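(* Let $\mathcal H$ be a real Hilbert space, $t_0>0$, let $f\in\mathcal C^2(\mathcal H)$ be convex with $S:=\operatorname{argmin}_{\mathcal H}f\neq\emptyset$, and let $e\in\mathcal C^1([t_0,+\infty[,\mathcal H)$ satisfy $\int_{t_0}^{+\infty}t\|e(t)\|dt<+\infty$ and $\int_{t_0}^{+\infty}t\|\dot e(t)\|dt<+\infty$. Let $\alpha>3$ and $\beta>0$. Then for any solution trajectory $x$ of $$\ddot x(t)+\frac{\alpha}{t}\dot x(t)+\beta\frac{d}{dt}\big(\nabla f(x(t))+e(t)\big)+\nabla f(x(t))+e(t)=0$$ the following hold: (i) $f(x(t))-\inf_{\mathcal H}f=o(1/t^2)$ as $t\to+\infty$; (ii) $\int_{t_0}^{+\infty}t^2\|\nabla f(x(t))\|^2dt<+\infty$; (iii) $\int_{t_0}^{+\infty}t\,(f(x(t))-\min_{\mathcal H}f)dt<+\infty$; (iv) for any $x^\star\in S$, $\int_{t_0}^{+\infty}t\langle\nabla f(x(t)),x(t)-x^\star\rangle dt<+\infty$; (v) $\int_{t_0}^{+\infty}t\|\dot x(t)\|^2dt<+\infty$; (vi) $\|\dot x(t)\|=o(1/t)$ as $t\to+\infty$. *)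

(* Defs.v *)
From HB Require Import structures.
From mathcomp Require Import all_boot all_order all_algebra.
From mathcomp Require Import all_classical all_reals all_analysis.
Set Implicit Arguments. Unset Strict Implicit. Unset Printing Implicit Defensive.
Import Order.TTheory GRing.Theory Num.Theory.
Import numFieldNormedType.Exports.
Local Open Scope classical_set_scope.
Local Open Scope ring_scope.

(* A real Hilbert space is a complete normed space H whose norm comes from
   an inner product [ip]: symmetric, bilinear, and |x| = sqrt <x,x>. *)
Definition is_inner_product {R : realType} (H : completeNormedModType R)
  (ip : H -> H -> R) : Prop :=
  [/\ (forall x y, ip x y = ip y x),
      (forall (a : R) x y z, ip (a *: x + y) z = a * ip x z + ip y z) &
      (forall x, `|x| = Num.sqrt (ip x x))].

Definition convex_fun {R : realType} (H : normedModType R) (f : H -> R) : Prop :=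
  forall (x y : H) (l : R), 0 <= l <= 1 ->
    f (l *: x + (1 - l) *: y) <= l * f x + (1 - l) * f y.

Definition is_gradient {R : realType} (H : completeNormedModType R)
  (ip : H -> H -> R) (f : H -> R) (g : H -> H) : Prop :=
  forall x, differentiable f x /\ forall v, 'd f x v = ip (g x) v.

(* f is C^2: f has a gradient g that is Frechet differentiable everywhere,
   with derivative x |-> 'd g x continuous for the operator norm. *)
Definition C2_fun {R : realType} (H : completeNormedModType R)
  (ip : H -> H -> R) (f : H -> R) (g : H -> H) : Prop :=
  is_gradient ip f g /\
  (forall x, differentiable g x) /\
  (forall x (eps : R), 0 < eps -> exists2 delta : R, 0 < delta &
     forall y, `|y - x| < delta ->
       forall v, `|'d g y v - 'd g x v| <= eps * `|v|).

(* Main.v *)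
Require Import Defs.
From HB Require Import structures.
From mathcomp Require Import all_boot all_order all_algebra.
From mathcomp Require Import all_classical all_reals all_analysis.
From mathcomp Require Import measurable_realfun ring lra.
Set Implicit Arguments. Unset Strict Implicit. Unset Printing Implicit Defensive.
Import Order.TTheory GRing.Theory Num.Theory.
Import numFieldNormedType.Exports.
Local Open Scope classical_set_scope.
Local Open Scope ring_scope.

(* Write g = grad f (x), w = g + e, p = x - x*, F = f(x) - min f, and fix
   2 < lam < alpha - 1 and mu = alpha - 1 - lam.  With
   v = lam p + t (x' + beta w), the Lyapunov function
     E = |v|^2 / 2 + (t^2 + (mu - 1) beta t) F + lam mu |p|^2 / 2
   satisfies, for large t and some constants kappa, c1, c2, c3 > 0,
     E' <= kappa t |e| (1 + E) - c1 t <p, g> - c2 t |x'|^2 - c3 t^2 |w|^2.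
   As t |e| is integrable, Gronwall's lemma bounds E and makes the three
   dissipated terms integrable, which gives (ii)-(v).  For (i) and (vi), the
   energy W = t^2 F + t^2 |x'|^2 / 2 has, since <(g(x))', x'> >= 0 by convexity,
   an upper-integrable derivative; as W / t is integrable too, W tends to 0. *)

(** * Calculus on a half-line: comparison, primitives, Gronwall, improper integrals *)

Section RealFunctions.
Context {R : realType}.
Implicit Types (T s t M : R) (k d F G K : R -> R).

Lemma is_derive_continuous_at (V : normedModType R) (u : R -> V) (t : R) du :
  is_derive t 1 u du -> {for t, continuous u}.
Proof.
move=> [du1 _]; apply: differentiable_continuous.
exact/derivable1_diffP.
Qed.

(** Mean value theorem for G - F. This comparison of increments takes the place of integrating
    inequalities in what follows. *)
Lemma derive_le_increment T F G (dF dG : R -> R) :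
  (forall t, T <= t -> is_derive t 1 F (dF t)) ->
  (forall t, T <= t -> is_derive t 1 G (dG t)) ->
  (forall t, T <= t -> dF t <= dG t) ->
  forall s t, T <= s -> s <= t -> F t - F s <= G t - G s.
Proof.
move=> hF hG hle s t Ts st.
have hD u : T <= u -> is_derive u 1 (G - F) (dG u - dF u).
  by move=> Tu; apply: is_deriveB; [exact: hG|exact: hF].
have [c||c] := @MVT_segment R (G - F) (fun u => dG u - dF u) s t st.
- by rewrite in_itv/= => /andP[sc _]; apply: hD; rewrite (le_trans Ts)// ltW.
- apply: continuous_in_subspaceT => u; rewrite inE/= in_itv/= => /andP[su _].
  by apply: is_derive_continuous_at (hD _ _); exact: le_trans su.
rewrite in_itv/= => /andP[sc _] hc.
rewrite -subr_ge0; suff -> : G t - G s - (F t - F s) = (G - F) t - (G - F) s.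
  by rewrite hc mulr_ge0 ?subr_ge0// hle//; exact: le_trans sc.
by rewrite /= !fctE; ring.
Qed.

Lemma derive_ge0_nondecreasing T F (dF : R -> R) :
  (forall t, T <= t -> is_derive t 1 F (dF t)) ->
  (forall t, T <= t -> 0 <= dF t) ->
  forall s t, T <= s -> s <= t -> F s <= F t.
Proof.
move=> hF h0 s t Ts st; rewrite -subr_ge0.
have := @derive_le_increment T (cst 0) F (cst 0) dF _ hF h0 s t Ts st.
by rewrite subrr; apply => u _; exact: is_derive_cst.
Qed.

Lemma continuous_primitive T k :
  (forall t, T <= t -> {for t, continuous k}) ->
  exists K, forall t, T <= t -> is_derive t 1 K (k t).
Proof.
(* Freezing k at its value in T on the left of T gives a function continuous on the whole line. *)
move=> ck; pose h t := k (Num.max T t).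
have ch : continuous h.
  move=> t; apply: (@continuous_comp _ _ _ (Num.max T) k).
    by apply: continuous_max; [exact: cvg_cst|exact: cvg_id].
  by apply: ck; rewrite le_max lexx.
(* Integrating from T - 1 makes T an interior point, so the derivative at T is two-sided. *)
exists (fun t => \int[lebesgue_measure]_(s in `[T - 1, t]) h s)%R => t Tt.
have [||||] := @continuous_FTC1_closed R h (T - 1) t (t + 1).
- by rewrite ltrDl.
- apply: continuous_compact_integrable; first exact: segment_compact.
  exact: continuous_subspaceT.
- by rewrite ltrBlDr (le_lt_trans Tt)// ltrDl.
- exact: ch.
move=> dK; rewrite derive1E => Kt; split => //.
by rewrite Kt /h max_r.
Qed.

(* For a continuous [k >= 0] this says that the integral of [k] over [T, +oo[ is
   finite; in this form the estimates only involve derivatives. *)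
Definition bounded_primitive T k := exists K M,
  (forall t, T <= t -> is_derive t 1 K (k t)) /\
  (forall t, T <= t -> `|K t| <= M).

Lemma bounded_primitive_tail T T' k : T <= T' ->
  bounded_primitive T k -> bounded_primitive T' k.
Proof.
move=> TT' [K [M [dK bK]]]; exists K, M; split=> t T't.
- by apply: dK; exact: le_trans T't.
- by apply: bK; exact: le_trans T't.
Qed.

Lemma bounded_primitive_eq T k d : (forall t, T <= t -> k t = d t) ->
  bounded_primitive T k -> bounded_primitive T d.
Proof.
move=> kd [K [M [dK bK]]]; exists K, M; split=> // t Tt.
by rewrite -kd//; exact: dK.
Qed.

Lemma bounded_primitiveD T k d : bounded_primitive T k ->
  bounded_primitive T d -> bounded_primitive T (fun t => k t + d t).
Proof.
move=> [K [M [dK bK]]] [D [N [dD bD]]]; exists (K + D), (M + N); split=> t Tt.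
- by apply: is_deriveD; [exact: dK|exact: dD].
- by rewrite (le_trans (ler_normD _ _))// lerD ?bK ?bD.
Qed.

Lemma bounded_primitiveZ T (c : R) k : bounded_primitive T k ->
  bounded_primitive T (fun t => c * k t).
Proof.
move=> [K [M [dK bK]]]; exists (c \*: K), (`|c| * M); split=> t Tt.
- by apply: is_deriveZ; exact: dK.
- by rewrite normrM ler_wpM2l// bK.
Qed.

Lemma bounded_primitive_le T k d :
  (forall t, T <= t -> {for t, continuous k}) ->
  (forall t, T <= t -> 0 <= k t <= d t) ->
  bounded_primitive T d -> bounded_primitive T k.
Proof.
move=> ck kd [D [M [dD bD]]]; have [K dK] := continuous_primitive ck.
exists K, (`|K T| + (M + M)); split => // t Tt.
have k0 u : T <= u -> 0 <= k u by move=> /kd/andP[].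
have kd' u : T <= u -> k u <= d u by move=> /kd/andP[].
have := derive_ge0_nondecreasing dK k0 (lexx T) Tt.
have := derive_le_increment dK dD kd' (lexx T) Tt.
have := bD _ Tt; have := bD _ (lexx T); rewrite !ler_norml => /andP[? ?] /andP[? ?] ? ?.
have := ler_norm (K T); have := ler_norm (- K T); rewrite normrN => ? ?.
by apply/andP; split; lra.
Qed.

(** With K' = k, the product (1 + phi) exp(-K) is nonincreasing, and K is bounded, so phi is at most
    some B. Then d <= (1 + B) k - phi', and the right-hand side has a bounded primitive up to the
    sign of phi, which is nonnegative. *)
Lemma gronwall_dissipation T (phi dphi k d : R -> R) :
  (forall t, T <= t -> is_derive t 1 phi (dphi t)) ->
  (forall t, T <= t -> 0 <= phi t) ->
  (forall t, T <= t -> 0 <= k t) -> bounded_primitive T k ->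
  (forall t, T <= t -> 0 <= d t) ->
  (forall t, T <= t -> {for t, continuous d}) ->
  (forall t, T <= t -> dphi t <= k t * (1 + phi t) - d t) ->
  (exists B, forall t, T <= t -> phi t <= B) /\ bounded_primitive T d.
Proof.
move=> dphiE phi0 k0 [K [M [dK bK]]] d0 cd hle.
have [B hB] : exists B, forall t, T <= t -> phi t <= B.
  pose h t := (1 + phi t) * expR (- K t).
  have dh t : T <= t -> is_derive t 1 h ((k t * (1 + phi t) - dphi t) * - expR (- K t)).
    move=> Tt; have dphit := dphiE _ Tt; have dKt := dK _ Tt.
    have de : is_derive t 1 (expR \o (fun u => - K u)) (expR (- K t) * - k t).
      exact: is_derive1_comp (is_derive_expR _) (is_deriveN dKt).
    have d1 : is_derive t 1 (fun u => 1 + phi u) (0 + dphi t).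
      exact: is_deriveD (is_derive_cst (1 : R^o) t 1) dphit.
    apply: is_derive_eq (is_deriveM d1 de) _.
    by rewrite /GRing.scale/=; ring.
  have hT t : T <= t -> h t <= h T.
    move=> Tt; rewrite -subr_le0.
    have d0' u : T <= u -> is_derive u 1 (cst (0 : R)) 0 by move=> _; exact: is_derive_cst.
    have /(_ _ T t (lexx T) Tt) := derive_le_increment dh d0'.
    rewrite subrr; apply=> u Tu.
    rewrite mulrN oppr_le0 mulr_ge0 ?expR_ge0// subr_ge0.
    by rewrite (le_trans (hle _ Tu))// gerBl d0.
  exists (h T * expR M) => t Tt.
  have : (1 + phi t) * expR (- K t) * expR (K t) <= h T * expR M.
    apply: ler_pM; rewrite ?expR_ge0 ?mulr_ge0 ?expR_ge0 ?addr_ge0 ?phi0//.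
    - exact: hT.
    - by rewrite ler_expR (le_trans (ler_norm _))// bK.
  by rewrite -mulrA -expRD addNr expR0 mulr1; lra.
split; first by exists B.
have [D dD] := continuous_primitive cd.
have bKM t : T <= t -> - M <= K t <= M by move=> /bK; rewrite ler_norml.
exists D, (`|D T| + (phi T + (1 + B) * (M + M))); split=> // t Tt.
have B0 : 0 <= B by rewrite (le_trans (phi0 _ (lexx T)))// hB.
have hG u : T <= u -> is_derive u 1 ((1 + B) \*: K - phi) ((1 + B) * k u - dphi u).
  by move=> Tu; apply: is_deriveB; [apply: is_deriveZ; exact: dK|exact: dphiE].
have := derive_ge0_nondecreasing dD d0 (lexx T) Tt.
have /(_ _ T t (lexx T) Tt) := derive_le_increment dD hG.
rewrite /= !fctE /GRing.scale/= => h1 h2.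
have {}h1 : D t - D T <= (1 + B) * (K t - K T) + phi T.
  have := h1 _; have := phi0 _ Tt => ? h3.
  apply: (@le_trans _ _ ((1 + B) * K t - phi t - ((1 + B) * K T - phi T))); last by lra.
  apply: h3 => u Tu; have := hle _ Tu.
  suff : k u * (1 + phi u) <= k u * (1 + B) by lra.
  by rewrite ler_wpM2l ?k0// lerD2l hB.
have h3 : (1 + B) * (K t - K T) <= (1 + B) * (M + M).
  rewrite ler_wpM2l ?addr_ge0//.
  by have := bKM _ Tt; have := bKM _ (lexx T); lra.
have := ler_norm (D T); have := ler_norm (- D T); rewrite normrN => ? ?.
by have := phi0 _ (lexx T); rewrite ler_norml => ?; apply/andP; split; lra.
Qed.

(** Since 1/t is not integrable at infinity, integrability of phi / t forces phi to be small at
    arbitrarily late times. After such a time phi can grow by no more than the remaining integral of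
    k, which is small as well. *)
Lemma nonneg_log_integrable_cvg0 T (phi dphi k : R -> R) : 0 < T ->
  (forall t, T <= t -> is_derive t 1 phi (dphi t)) ->
  (forall t, T <= t -> 0 <= phi t) ->
  (forall t, T <= t -> 0 <= k t) -> bounded_primitive T k ->
  (forall t, T <= t -> dphi t <= k t) ->
  bounded_primitive T (fun t => phi t / t) ->
  phi @ +oo --> 0.
Proof.
move=> T0 dphiE phi0 k0 [K [M [dK bK]]] hle [D [N [dD bD]]].
have Knd := derive_ge0_nondecreasing dK k0.
apply/cvgr0Pnorm_le => eps eps0.
have e2 : 0 < eps / 2 by rewrite divr_gt0.
(* K is nondecreasing and bounded; past a point T1 where it is within eps / 2 of its supremum, it
   grows by at most eps / 2. *)
pose A := K @` [set t | T <= t].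
have supA : has_sup A.
  split; first by exists (K T), T => /=.
  by exists M => _ [t /= Tt <-]; rewrite (le_trans (ler_norm _))// bK.
have [_ [T1 /= TT1 <-] hT1] := sup_adherent e2 supA.
have hK t : T1 <= t -> K t - K T1 <= eps / 2.
  move=> T1t; have : K t <= sup A.
    by apply: sup_upper_bound => //; exists t => //=; exact: le_trans T1t.
  by lra.
have [s T1s hs] : exists2 s, T1 <= s & phi s <= eps / 2.
  apply: contrapT => /forall2NP hn.
  have {}hn u : T1 <= u -> eps / 2 < phi u.
    by move=> T1u; have [//|/negP] := hn u; rewrite -ltNge.
  have pos u : T1 <= u -> 0 < u by move=> T1u; rewrite (lt_le_trans T0)// (le_trans TT1).
  have dln u : T1 <= u -> is_derive u 1 ((eps / 2) \*: (@ln R)) (eps / 2 * u^-1).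
    by move=> T1u; apply: is_deriveZ; apply: is_derive1_ln; exact: pos.
  have dD' u : T1 <= u -> is_derive u 1 D (phi u / u).
    by move=> T1u; apply: dD; exact: le_trans T1u.
  (* If phi stayed above eps / 2 after T1, D would grow by at least (eps / 2) (ln u - ln T1). This u
     makes that at least 2 N + 1, whereas |D| <= N allows only 2 N. *)
  pose u := Num.max T1 (expR (2 / eps * (N + N + 1) + ln T1)).
  have T1u : T1 <= u by rewrite le_max lexx.
  have hln v : T1 <= v -> eps / 2 * v^-1 <= phi v / v.
    by move=> T1v; rewrite ler_pM2r ?invr_gt0 ?pos// ltW// hn.
  have := derive_le_increment dln dD' hln (lexx T1) T1u.
  rewrite /= /GRing.scale/= -mulrBr => h1.
  have : 2 / eps * (N + N + 1) <= ln u - ln T1.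
    rewrite lerBrDr -[leLHS]expRK ler_ln ?posrE ?expR_gt0 ?pos//.
    by rewrite le_max lexx orbT.
  rewrite -(ler_pM2l e2) => h2.
  have := bD _ TT1; have := bD u (le_trans TT1 T1u).
  rewrite !ler_norml => /andP[? ?] /andP[? ?].
  have : eps / 2 * (2 / eps * (N + N + 1)) = N + N + 1 by field; rewrite gt_eqF.
  by lra.
near=> t.
have st : s <= t by near: t; apply: nbhs_pinfty_ge; exact: num_real.
have Ts : T <= s := le_trans TT1 T1s.
rewrite ger0_norm ?phi0 ?(le_trans Ts)//.
have := derive_le_increment dphiE dK hle Ts st.
have := hK _ (le_trans T1s st).
by have := Knd _ _ TT1 T1s; lra.
Unshelve. all: end_near. Qed.

(** The Lyapunov estimate holds only for large times; a nondecreasing primitive is bounded on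
    [T, T'] by its value at T', so the conclusion carries back to the initial time. *)
Lemma bounded_primitive_extend T T' k : T <= T' ->
  (forall t, T <= t -> {for t, continuous k}) ->
  (forall t, T <= t -> 0 <= k t) ->
  bounded_primitive T' k -> bounded_primitive T k.
Proof.
move=> TT' ck k0 [D [M [dD bD]]]; have [K dK] := continuous_primitive ck.
have Knd := derive_ge0_nondecreasing dK k0.
have dK' u : T' <= u -> is_derive u 1 K (k u).
  by move=> T'u; apply: dK; exact: le_trans T'u.
have hb t : T <= t -> K t <= K T' + (M + M).
  move=> Tt; have [tT'|/ltW T't] := leP t T'.
    rewrite (le_trans (Knd _ _ Tt tT'))//.
    by have := bD _ (lexx T'); rewrite ler_norml => /andP[? ?]; lra.
  have := derive_le_increment dK' dD (fun u _ => lexx (k u)) (lexx T') T't.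
  have := bD _ (lexx T'); have := bD _ T't.
  by rewrite !ler_norml => /andP[? ?] /andP[? ?]; lra.
exists K, (`|K T| + `|K T' + (M + M)|); split=> // t Tt.
have := hb _ Tt; have := Knd _ _ (lexx T) Tt.
have := ler_norm (K T' + (M + M)); have := normr_ge0 (K T' + (M + M)).
have := normr_ge0 (K T); have := ler_norm (- K T); rewrite normrN => ? ? ? ? ? ?.
by rewrite ler_norml; apply/andP; split; lra.
Qed.

(** A bounded nondecreasing primitive converges at infinity, so the fundamental theorem of calculus
    on [T, +oo[ gives a finite integral. *)
Lemma bounded_primitive_integral_lty T k :
  (forall t, T <= t -> {for t, continuous k}) ->
  (forall t, T <= t -> 0 <= k t) -> bounded_primitive T k ->
  (\int[lebesgue_measure]_(t in `[T, +oo[) (k t)%:E < +oo)%E.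
Proof.
move=> ck k0 [K [M [dK bK]]]; have Knd := derive_ge0_nondecreasing dK k0.
have maxT t : T <= Num.max T t by rewrite le_max lexx.
(* Composing with [Num.max T] makes K monotone on the whole line, as the monotone convergence lemma
   requires. *)
have cvK : K r @[r --> +oo] --> sup (range (fun t => K (Num.max T t))).
  have : K (Num.max T r) @[r --> +oo] --> sup (range (fun t => K (Num.max T t))).
    apply: nondecreasing_cvgr => [u v uv|].
      by apply: Knd => //; rewrite ge_max !le_max lexx uv orbT.
    by exists M => _ [u _ <-]; rewrite (le_trans (ler_norm _))// bK.
  apply: cvg_trans; apply: near_eq_cvg; near=> t.
  by rewrite max_r//; near: t; apply: nbhs_pinfty_ge; exact: num_real.
rewrite (@ge0_continuous_FTC2y _ _ K _ _ k0 _ cvK) ?ltry//.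
- by apply: continuous_in_subspaceT => u; rewrite inE/= in_itv/= andbT; exact: ck.
- by move=> u /ltW /dK[].
- by apply: cvg_at_right_filter; exact: is_derive_continuous_at (dK _ (lexx T)).
- by move=> u; rewrite in_itv/= andbT => /ltW /dK[_]; rewrite derive1E.
Unshelve. all: end_near. Qed.

(** The increment of K over [T, t] is the integral of k there, which is at most the full integral
    because k >= 0. *)
Lemma integral_lty_bounded_primitive T k :
  (forall t, T <= t -> {for t, continuous k}) ->
  (forall t, T <= t -> 0 <= k t) ->
  (\int[lebesgue_measure]_(t in `[T, +oo[) (k t)%:E < +oo)%E ->
  bounded_primitive T k.
Proof.
move=> ck k0 intk; have [K dK] := continuous_primitive ck.
have Knd := derive_ge0_nondecreasing dK k0.
set I := (\int[_]_(_ in _) _)%E in intk.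
have ckT : {within `[T, +oo[, continuous k}.
  by apply: continuous_in_subspaceT => u; rewrite inE/= in_itv/= andbT; exact: ck.
have Ifin : I \is a fin_num.
  rewrite ge0_fin_numE//; apply: integral_ge0 => u /=.
  by rewrite in_itv/= andbT lee_fin; exact: k0.
have hI t : T < t -> K t - K T <= fine I.
  move=> Tt; rewrite -lee_fin fineK// EFinB.
  rewrite -(@continuous_FTC2 _ k K T t Tt).
  - apply: ge0_subset_integral => //.
    + apply/measurable_EFinP; apply: subspace_continuous_measurable_fun => //.
    + by move=> u /=; rewrite in_itv/= andbT lee_fin; exact: k0.
    + by move=> u /=; rewrite !in_itv/= andbT => /andP[].
  - by apply: continuous_subspaceW ckT => u /=; rewrite !in_itv/= andbT => /andP[].
  - split.
    + by move=> u; rewrite in_itv/= => /andP[/ltW /dK[]].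
    + apply: cvg_at_right_filter; exact: is_derive_continuous_at (dK _ (lexx T)).
    + apply: cvg_at_left_filter; exact: is_derive_continuous_at (dK _ (ltW Tt)).
  - by move=> u; rewrite in_itv/= => /andP[/ltW /dK[_]]; rewrite derive1E.
exists K, (`|K T| + `|fine I|); split => // t Tt.
have h : K t - K T <= `|fine I|.
  move: Tt; rewrite le_eqVlt => /predU1P[<-|Tt]; first by rewrite subrr.
  exact: le_trans (hI _ Tt) (ler_norm _).
have := Knd _ _ (lexx T) Tt; have := ler_norm (K T); have := ler_norm (- K T).
rewrite normrN => ? ? ?; have : 0 <= `|fine I| by [].
by rewrite ler_norml => ?; apply/andP; split; lra.
Qed.
End RealFunctions.

(** * Difference quotients and the product rule for bounded bilinear maps *)

Lemma is_derive_cvg (R : realType) (E : normedModType R) (u : R -> E) (t : R) du :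
  is_derive t 1 u du <-> (fun h => h^-1 *: (u (h + t) - u t)) @ 0^' --> du.
Proof.
have hE : (fun h : R => h^-1 *: (u (h + t) - u t)) =
    (fun h : R => h^-1 *: ((u \o shift t) (h *: (1 : R)) - u t)).
  by apply/funext => h /=; rewrite /GRing.scale/= mulr1.
rewrite hE; split; first by move=> [+ <-].
by move=> h; split; [exact: cvgP h|exact: cvg_lim h].
Qed.

Section BoundedBilinear.
Context {R : realType} {U V W : normedModType R} (B : U -> V -> W).
Hypothesis Bl : forall (a : R) u u' v, B (a *: u + u') v = a *: B u v + B u' v.
Hypothesis Br : forall (a : R) u v v', B u (a *: v + v') = a *: B u v + B u v'.
Hypothesis Bb : forall u v, `|B u v| <= `|u| * `|v|.

Lemma bilinearBl u u' v : B (u - u') v = B u v - B u' v.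
Proof. by rewrite addrC -scaleN1r Bl scaleN1r addrC. Qed.

Lemma bilinearBr u v v' : B u (v - v') = B u v - B u v'.
Proof. by rewrite addrC -scaleN1r Br scaleN1r addrC. Qed.

Lemma bilinearZl a u v : B (a *: u) v = a *: B u v.
Proof.
have B0 : B 0 v = 0 by rewrite -(subrr 0) bilinearBl subrr.
by rewrite -[a *: u]addr0 Bl B0 addr0.
Qed.

Lemma bilinearZr a u v : B u (a *: v) = a *: B u v.
Proof.
have B0 : B u 0 = 0 by rewrite -(subrr 0) bilinearBr subrr.
by rewrite -[a *: v]addr0 Br B0 addr0.
Qed.

Lemma cvg_bilinear (T : Type) (F : set_system T) {FF : Filter F}
    (u : T -> U) (v : T -> V) a b :
  u @ F --> a -> v @ F --> b -> (fun s => B (u s) (v s)) @ F --> B a b.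
Proof.
move=> ua vb; apply/subr_cvg0/norm_cvg0P.
apply: (@squeeze_cvgr _ _ _ _ (cst 0) (fun s => `|u s - a| * `|v s| + `|a| * `|v s - b|)).
- near=> s; rewrite normr_ge0/=.
  have -> : B (u s) (v s) - B a b = B (u s - a) (v s) + B a (v s - b).
    by rewrite bilinearBl bilinearBr addrA subrK.
  by rewrite (le_trans (ler_normD _ _))// lerD.
- exact: cvg_cst.
- rewrite [X in _ --> X](_ : _ = 0 * `|b| + `|a| * 0); last by rewrite mul0r mulr0 addr0.
  apply: cvgD; apply: cvgM.
  + exact/norm_cvg0P/subr_cvg0.
  + exact: cvg_norm.
  + exact: cvg_cst.
  + exact/norm_cvg0P/subr_cvg0.
Unshelve. all: end_near. Qed.

(** The product rule is proved once for bilinear maps with |B u v| <= |u| |v|, and serves both for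
    the inner product and for multiplication of a vector by a scalar. *)
Lemma is_derive_bilinear (u : R -> U) (v : R -> V) (t : R) du dv :
  is_derive t 1 u du -> is_derive t 1 v dv ->
  is_derive t 1 (fun s => B (u s) (v s)) (B du (v t) + B (u t) dv).
Proof.
move=> hu hv; apply/is_derive_cvg.
have -> : (fun h => h^-1 *: (B (u (h + t)) (v (h + t)) - B (u t) (v t))) =
  (fun h => B (h^-1 *: (u (h + t) - u t)) (v (h + t)) +
            B (u t) (h^-1 *: (v (h + t) - v t))).
  apply/funext => h; rewrite bilinearZl bilinearZr -scalerDr.
  by rewrite bilinearBl bilinearBr addrA subrK.
apply: cvgD; apply: cvg_bilinear.
- exact/is_derive_cvg.
- have h : (v \o shift t) @ (0 : R) --> v t.
    by rewrite cvg_comp_shift add0r; exact: is_derive_continuous_at hv.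
  exact: cvg_within_filter h.
- exact: cvg_cst.
- exact/is_derive_cvg.
Qed.
End BoundedBilinear.

(** * Inner product identities, and gradients of convex functions *)

Section InnerProduct.
Context {R : realType} {H : completeNormedModType R} {ip : H -> H -> R}.
Hypothesis hip : is_inner_product ip.
Implicit Types u v w : H.

Lemma ipC u v : ip u v = ip v u.
Proof. by have [] := hip. Qed.

Lemma ip_linearl (a : R) u v w : ip (a *: u + v) w = a *: ip u w + ip v w.
Proof. by have [_ h _] := hip; exact: h. Qed.

Lemma ip_linearr (a : R) u v w : ip w (a *: u + v) = a *: ip w u + ip w v.
Proof. by rewrite ipC ip_linearl ![ip w _]ipC. Qed.

Lemma ipDl u v w : ip (u + v) w = ip u w + ip v w.
Proof. by rewrite -[u]scale1r ip_linearl !scale1r. Qed.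

Lemma ipDr u v w : ip w (u + v) = ip w u + ip w v.
Proof. by rewrite ipC ipDl ![ip w _]ipC. Qed.

Lemma ipZl (a : R) u v : ip (a *: u) v = a * ip u v.
Proof. exact: (bilinearZl ip_linearl). Qed.

Lemma ipZr (a : R) u v : ip u (a *: v) = a * ip u v.
Proof. by rewrite ipC ipZl ipC. Qed.

Lemma ipNl u v : ip (- u) v = - ip u v.
Proof. by rewrite -scaleN1r ipZl mulN1r. Qed.

Lemma ipNr u v : ip u (- v) = - ip u v.
Proof. by rewrite ipC ipNl ipC. Qed.

Lemma ip0l u : ip 0 u = 0.
Proof. by rewrite -(scale0r 0) ipZl mul0r. Qed.

(** Positivity of [ip u u] is derived from the norm formula: [Num.sqrt] is 0 on negative numbers, so
    a negative [ip u u] would give |u| = 0, hence u = 0 and [ip u u] = 0. *)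
Lemma ip_sqr u : ip u u = `|u| ^+ 2.
Proof.
have [_ _ hn] := hip; rewrite hn.
have [u0|u0] := leP 0 (ip u u); first by rewrite sqr_sqrtr.
have : `|u| = 0 by rewrite hn ler0_sqrtr// ltW.
by move=> /normr0_eq0 u00; rewrite u00 ip0l ltxx in u0.
Qed.

Lemma ip_ge0 u : 0 <= ip u u.
Proof. by rewrite ip_sqr sqr_ge0. Qed.

Lemma ip_cauchy_schwarz u v : `|ip u v| <= `|u| * `|v|.
Proof.
have [->|v0] := eqVneq v 0; first by rewrite ipC ip0l !normr0 mulr0.
have nv0 : 0 < `|v| ^+ 2 by rewrite exprn_gt0// normr_gt0.
rewrite -ler_sqr ?nnegrE ?mulr_ge0// real_normK ?num_real// exprMn.
(* Expand the squared norm of the component of u orthogonal to v. *)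
have := ip_ge0 (u - (ip u v / `|v| ^+ 2) *: v).
rewrite !(ipDl, ipDr, ipNl, ipNr, ipZl, ipZr) (ipC v u) !ip_sqr => h.
have {h} : 0 <= (`|u| ^+ 2 - ip u v ^+ 2 / `|v| ^+ 2) * `|v| ^+ 2.
  rewrite mulr_ge0 ?(ltW nv0)//; apply: (le_trans h); rewrite le_eqVlt.
  by apply/orP; left; apply/eqP; field; rewrite normr_eq0.
by rewrite mulrBl divfK ?subr_ge0// gt_eqF.
Qed.

Lemma ip_le_norm u v : ip u v <= `|u| * `|v|.
Proof. exact: le_trans (ler_norm _) (ip_cauchy_schwarz _ _). Qed.

Lemma ip_ge_norm u v : - (`|u| * `|v|) <= ip u v.
Proof. by rewrite lerNl (le_trans (ler_norm _))// normrN ip_cauchy_schwarz. Qed.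

Lemma is_derive_ip (u v : R -> H) (t : R) du dv :
  is_derive t 1 u du -> is_derive t 1 v dv ->
  is_derive t 1 (fun s => ip (u s) (v s)) (ip du (v t) + ip (u t) dv).
Proof.
exact: (is_derive_bilinear (W := R^o) ip_linearl
  (fun a u v w => ip_linearr a v w u) ip_cauchy_schwarz).
Qed.

Lemma cvg_ip (T : Type) (F : set_system T) {FF : Filter F} (u v : T -> H) a b :
  u @ F --> a -> v @ F --> b -> (fun s => ip (u s) (v s)) @ F --> ip a b.
Proof.
exact: (cvg_bilinear (W := R^o) ip_linearl
  (fun a u v w => ip_linearr a v w u) ip_cauchy_schwarz).
Qed.

Lemma is_derive_scaling (a : R -> R) (u : R -> H) (t : R) da du :
  is_derive t 1 a da -> is_derive t 1 u du ->
  is_derive t 1 (fun s => a s *: u s) (da *: u t + a t *: du).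
Proof.
apply: (is_derive_bilinear (U := R^o) (B := fun c w => c *: w)).
- by move=> c w w' v /=; rewrite scalerDl scalerA.
- by move=> c w v v' /=; rewrite scalerDr !scalerA mulrC.
- by move=> c v; rewrite normrZ.
Qed.

(** The inner product of the two difference quotients is h^-2 times a nonnegative number; pass to
    the limit. With u the gradient along the trajectory and v the trajectory, this gives the sign of
    <(g(x))', x'>. *)
Lemma derive_ip_ge0 (u v : R -> H) (t : R) du dv :
  is_derive t 1 u du -> is_derive t 1 v dv ->
  (forall s, 0 <= ip (u s - u t) (v s - v t)) -> 0 <= ip du dv.
Proof.
move=> /is_derive_cvg hu /is_derive_cvg hv h0.
apply: (cvgr_to_ge (cvg_ip hu hv)); near=> h.
by rewrite ipZl ipZr !mulrA -expr2 mulr_ge0 ?sqr_ge0.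
Unshelve. all: end_near. Qed.

Lemma is_gradient_chain (f : H -> R) g (x : R -> H) (t : R) dx :
  is_gradient ip f g -> is_derive t 1 x dx ->
  is_derive t 1 (fun s => f (x s)) (ip (g (x t)) dx).
Proof.
move=> /(_ (x t))[df dfE] [dx1 dxE].
have dx2 : differentiable x t by apply/derivable1_diffP.
have hc : differentiable (f \o x) t by apply: differentiable_comp.
split; first exact: diff_derivable.
by rewrite deriveE// diff_comp//= dfE -deriveE// dxE.
Qed.

(** By convexity the difference quotients of f along the segment from u to v are at most f v - f u;
    their limit at 0 is the directional derivative. *)
Lemma convex_gradient_le (f : H -> R) g u v :
  convex_fun f -> is_gradient ip f g -> f u + ip (g u) (v - u) <= f v.
Proof.
move=> cf gf; rewrite -lerBrDl.
have : is_derive (0 : R) 1 (fun s => f (s *: (v - u) + u)) (ip (g u) (v - u)).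
  have dx : is_derive (0 : R) 1 (fun s : R => s *: (v - u) + u) (v - u).
    have ds := is_derive_scaling (is_derive_id (0 : R) 1)
      (is_derive_cst (v - u) (0 : R) 1).
    apply: is_derive_eq (is_deriveD ds (is_derive_cst u (0 : R) 1)) _.
    by rewrite scale1r scaler0 !addr0.
  by have := is_gradient_chain gf dx; rewrite /= scale0r add0r.
move=> /is_derive_cvg h.
(* Only the right-hand limit is kept, since the convexity inequality needs 0 <= s <= 1. *)
have {}h : (fun h => h^-1 *: (f ((h + 0) *: (v - u) + u) - f (0 *: (v - u) + u)))
    @ 0^'+ --> ip (g u) (v - u).
  exact: cvg_dnbhs_at_right.
apply: (cvgr_to_le h); near=> s.
have s0 : 0 < s by [].
have s1 : s <= 1 by near: s; exact: nbhs_right_le.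
rewrite addr0 scale0r add0r /GRing.scale/= mulrC ler_pdivrMr//.
have -> : s *: (v - u) + u = s *: v + (1 - s) *: u.
  by rewrite scalerBr scalerBl scale1r addrAC -addrA.
have := cf v u s; rewrite ltW// s1 => /(_ isT); lra.
Unshelve. all: end_near. Qed.

(** Add the gradient inequality from u to v and the one from v to u. *)
Lemma convex_gradient_monotone (f : H -> R) g u v :
  convex_fun f -> is_gradient ip f g -> 0 <= ip (g u - g v) (u - v).
Proof.
move=> cf gf; have := convex_gradient_le u v cf gf.
have := convex_gradient_le v u cf gf.
by rewrite !(ipDl, ipDr, ipNl, ipNr); lra.
Qed.

End InnerProduct.

(** * Derivative rules in the explicit [fun s => ...] form in which the energies are written *)

Section PointwiseDerivatives.
Context {R : realType} {V : normedModType R}.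

Lemma is_derive_addf (u v : R -> V) (t : R) du dv :
  is_derive t 1 u du -> is_derive t 1 v dv ->
  is_derive t 1 (fun s => u s + v s) (du + dv).
Proof. exact: is_deriveD. Qed.

Lemma is_derive_scalef (c : R) (u : R -> V) (t : R) du :
  is_derive t 1 u du -> is_derive t 1 (fun s => c *: u s) (c *: du).
Proof. exact: is_deriveZ. Qed.

Lemma is_derive_cmulf (c : R) (a : R -> R) (t : R) da :
  is_derive t 1 a da -> is_derive t 1 (fun s => c * a s) (c * da).
Proof. exact: is_deriveZ. Qed.

Lemma is_derive_mulf (a b : R -> R) (t : R) da db :
  is_derive t 1 a da -> is_derive t 1 b db ->
  is_derive t 1 (fun s => a s * b s) (da * b t + a t * db).
Proof.
move=> ha hb; apply: is_derive_eq (is_deriveM ha hb) _.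
by rewrite /GRing.scale/=; ring.
Qed.

Lemma is_derive_sqrf (t : R) : is_derive t 1 (fun s => s ^+ 2) (2 * t).
Proof.
apply: is_derive_eq (is_derive_mulf (is_derive_id t 1) (is_derive_id t 1)) _; ring.
Qed.
End PointwiseDerivatives.

(** * Pointwise inequalities behind the derivatives of the two energies *)

Section Energies.
Context {R : realType} {H : completeNormedModType R} {ip : H -> H -> R}.
Hypothesis hip : is_inner_product ip.

(** Turns a factor that is linear in a norm into 1 + energy, the form that [gronwall_dissipation]
    accepts. *)
Lemma le_1Dsqr (y Q : R) : y ^+ 2 / 2 <= Q -> y <= 1 + Q.
Proof. by have := sqr_ge0 (y - 1); rewrite sqrrB1; lra. Qed.

(* The perturbation enters through [q]; since t q = v - lam p - t beta w, it is
   controlled by [E] (through v and p) and by the dissipation of w. *)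
Lemma lyapunov_derivative_le (lam mu beta t C F E : R) (p q g e : H) :
  let w := g + e in
  let v := lam *: p + t *: (q + beta *: w) in
  2 < lam -> 0 < mu -> 0 < beta -> 0 <= F -> F <= ip p g ->
  2 * beta <= t -> `|(mu - 1) * beta| <= t / 2 ->
  (mu - 1) * beta + lam * beta <= (lam - 2) / 2 * t -> t * `|e| <= C ->
  E = ip v v / 2 + (t ^+ 2 + (mu - 1) * beta * t) * F + lam * mu / 2 * ip p p ->
  ip v (- mu *: q - (t - beta) *: w) + (2 * t + (mu - 1) * beta) * F
   + (t ^+ 2 + (mu - 1) * beta * t) * ip g q + lam * mu * ip p q
  <= (3 / 2 + (1 + lam * mu / 2) / 2 + 9 / 4 * beta * C) * (t * `|e|) * (1 + E)
     - ((lam - 2) / 2 * (t * ip p g) + mu * (t * ip q q)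
        + beta / 4 * (t ^+ 2 * ip w w)).
Proof.
move=> w v lam2 mu0 beta0 F0 Fpg tbeta /[!ler_norml]/andP[mb1 mb2] lamt tC EE.
have t0 : 0 < t by lra.
set n := `|e| in tC *; have n0 : 0 <= n by rewrite /n.
have C0 : 0 <= C by rewrite (le_trans _ tC)// mulr_ge0// ltW.
(* [t * d1] is the coefficient of F in E; in this range of t, d1 lies between t / 2 and 3 t / 2. *)
pose d1 := t + (mu - 1) * beta.
have d1l : t / 2 <= d1 by rewrite /d1; lra.
have d1u : d1 <= 3 / 2 * t by rewrite /d1; lra.
have d10 : 0 <= d1 by lra.
have dF0 : 0 <= (t ^+ 2 + (mu - 1) * beta * t) * F.
  have -> : t ^+ 2 + (mu - 1) * beta * t = t * d1 by rewrite /d1; ring.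
  by rewrite !mulr_ge0// ltW.
have pp0 := ip_ge0 hip p; have vv0 := ip_ge0 hip v; have ww0 := ip_ge0 hip w.
have lm0 : 0 < lam * mu by rewrite mulr_gt0//; lra.
have lmpp : 0 <= lam * mu / 2 * ip p p by rewrite mulr_ge0//; lra.
have E0 : 0 <= E by lra.
have tn0 : 0 <= t * n by rewrite mulr_ge0// ltW.
set X := t * n * (1 + E).
have nX : t * n <= X by rewrite /X -[leLHS]mulr1 ler_wpM2l// lerDl.
have h1 : - (d1 * ip v e) <= 3 / 2 * X.
  have vE : `|v| <= 1 + E by apply: le_1Dsqr; rewrite -(ip_sqr hip); lra.
  have ve := ip_ge_norm hip v e.
  apply: (@le_trans _ _ (d1 * ((1 + E) * n))).
    rewrite -mulrN ler_wpM2l// lerNl (le_trans _ ve)// lerN2.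
    by rewrite ler_wpM2r.
  rewrite /X; have -> : 3 / 2 * (t * n * (1 + E)) = 3 / 2 * t * ((1 + E) * n) by ring.
  by rewrite ler_wpM2r// mulr_ge0//; lra.
have h2 : lam * mu * beta * ip p e <= (1 + lam * mu / 2) / 2 * X.
  have pE : lam * mu * `|p| <= (1 + lam * mu / 2) * (1 + E).
    apply: (@le_trans _ _ (lam * mu * ((1 + ip p p) / 2))).
      rewrite ler_wpM2l ?(ltW lm0)// (ip_sqr hip).
      by have := sqr_ge0 (`|p| - 1); rewrite sqrrB1; lra.
    have : 0 <= lam * mu / 2 * E by rewrite mulr_ge0//; lra.
    lra.
  apply: (@le_trans _ _ (beta * (lam * mu * `|p| * n))).
    have -> : lam * mu * beta * ip p e = beta * (lam * mu * ip p e) by ring.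
    rewrite ler_wpM2l ?(ltW beta0)// -[leRHS]mulrA ler_wpM2l ?(ltW lm0)//.
    exact: ip_le_norm.
  have -> : (1 + lam * mu / 2) / 2 * X = t / 2 * ((1 + lam * mu / 2) * (1 + E) * n).
    by rewrite /X; ring.
  apply: ler_pM; [exact: ltW| |lra|].
  - by rewrite !mulr_ge0//; lra.
  - by rewrite ler_wpM2r.
(* Young's inequality, in the form (|w| / 2 - 3 |e| / 2)^2 >= 0, spends beta / 4 of the dissipation
   in w. The remaining (t |e|)^2 is at most C t |e|. *)
have h3 : d1 * t * beta * ip w e <= beta / 4 * (t ^+ 2 * ip w w) + 9 / 4 * beta * C * X.
  have we : d1 * ip w e <= t * (ip w w / 4 + 9 / 4 * n ^+ 2).
    apply: (@le_trans _ _ (d1 * (`|w| * n))).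
      by rewrite ler_wpM2l// ip_le_norm.
    apply: (@le_trans _ _ (3 / 2 * t * (`|w| * n))).
      by rewrite ler_wpM2r// mulr_ge0.
    have -> : 3 / 2 * t * (`|w| * n) = t * (3 / 2 * (`|w| * n)) by ring.
    rewrite ler_wpM2l ?(ltW t0)// (ip_sqr hip).
    have := sqr_ge0 (`|w| / 2 - 3 / 2 * n).
    have -> : (`|w| / 2 - 3 / 2 * n) ^+ 2 =
      `|w| ^+ 2 / 4 + 9 / 4 * n ^+ 2 - 3 / 2 * (`|w| * n) by field.
    by rewrite subr_ge0.
  have tb0 : 0 <= t * beta by rewrite mulr_ge0// ltW.
  have := ler_wpM2l tb0 we.
  have -> : t * beta * (d1 * ip w e) = d1 * t * beta * ip w e by ring.
  move=> /le_trans; apply.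
  have -> : t * beta * (t * (ip w w / 4 + 9 / 4 * n ^+ 2)) =
    beta / 4 * (t ^+ 2 * ip w w) + 9 / 4 * beta * (t * n * (t * n)) by ring.
  rewrite lerD2l -[leRHS]mulrA ler_wpM2l//; first by lra.
  by apply: ler_pM.
(* Replacing F by <p, g> leaves the coefficient (2 - lam) t + (mu - 1 + lam) beta, whose constant
   part is absorbed by half of (lam - 2) t for large t. *)
have h4 : (2 * t + (mu - 1) * beta) * F - lam * (t - beta) * ip p g <=
    - ((lam - 2) / 2 * (t * ip p g)).
  have h5 : (2 * t + (mu - 1) * beta) * F <= (2 * t + (mu - 1) * beta) * ip p g.
    by rewrite ler_wpM2l//; lra.
  have h6 : (2 * t + (mu - 1) * beta - lam * (t - beta)) * ip p g <=
      (- ((lam - 2) / 2 * t)) * ip p g.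
    by rewrite ler_wpM2r//; lra.
  lra.
(* As t - beta >= t / 2, the dissipation in w has coefficient at least beta / 2; after [h3] has used
   beta / 4, another beta / 4 is left. *)
have h5 : beta / 2 * (t ^+ 2 * ip w w) <= t * beta * (t - beta) * ip w w.
  have -> : beta / 2 * (t ^+ 2 * ip w w) = t * beta * (t / 2) * ip w w by ring.
  rewrite ler_wpM2r// ler_wpM2l//; last by lra.
  by rewrite mulr_ge0// ltW.
have vE : forall u, ip v u = lam * ip p u + t * (ip q u + beta * ip w u).
  by move=> u; rewrite /v !(ipDl hip, ipZl hip).
(* The coefficients of E are tuned for this identity: (mu - 1) beta makes the <q, w> terms cancel,
   and lam mu the <p, q> terms. *)
have id : ip v (- mu *: q - (t - beta) *: w) + (2 * t + (mu - 1) * beta) * F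
   + (t ^+ 2 + (mu - 1) * beta * t) * ip g q + lam * mu * ip p q =
   ((2 * t + (mu - 1) * beta) * F - lam * (t - beta) * ip p g)
   + - (d1 * ip v e) + lam * mu * beta * ip p e + d1 * t * beta * ip w e
   - mu * (t * ip q q) - t * beta * (t - beta) * ip w w.
  rewrite !vE /w !(ipDl hip, ipDr hip, ipNr hip, ipZr hip).
  rewrite (ipC hip g q) (ipC hip e q) (ipC hip e g) /d1; ring.
rewrite id -[X in _ <= X - _]mulrA -/X; lra.
Qed.

(** The <g, q> terms cancel, the friction -alpha t |q|^2 outweighs t |q|^2 since alpha > 1, and the
    term in <dg, q> has a favourable sign. What remains is 2 t F and the perturbation, bounded
    through t |q| <= 1 + W. *)
Lemma kinetic_derivative_le (alpha beta t F W : R) (q g e dg de : H) :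
  1 < alpha -> 0 < beta -> 0 < t -> 0 <= F -> 0 <= ip dg q ->
  W = t ^+ 2 * F + t ^+ 2 * ip q q / 2 ->
  2 * t * F + t ^+ 2 * ip g q + t * ip q q
   + t ^+ 2 * ip q (- (alpha / t) *: q - beta *: (dg + de) - (g + e))
  <= (2 * (t * F) + t * `|e| + beta * (t * `|de|)) * (1 + W).
Proof.
move=> alpha1 beta0 t0 F0 mono WE.
have t20 : 0 <= t ^+ 2 by rewrite sqr_ge0.
have qq0 := ip_ge0 hip q.
have tF0 : 0 <= t ^+ 2 * F by rewrite mulr_ge0.
have tq0 : 0 <= t ^+ 2 * ip q q by rewrite mulr_ge0.
have W0 : 0 <= W by lra.
have tqW : t * `|q| <= 1 + W.
  by apply: le_1Dsqr; rewrite exprMn -(ip_sqr hip); lra.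
have bound (u : H) : - (t ^+ 2 * ip q u) <= t * `|u| * (1 + W).
  apply: (@le_trans _ _ (t * `|u| * (t * `|q|))).
    have -> : t * `|u| * (t * `|q|) = t ^+ 2 * (`|q| * `|u|) by ring.
    by rewrite -mulrN ler_wpM2l// lerNl ip_ge_norm.
  by rewrite ler_wpM2l// mulr_ge0// ltW.
have h1 : 2 * (t * F) <= 2 * (t * F) * (1 + W).
  by rewrite -[leLHS]mulr1 ler_wpM2l// ?lerDl// !mulr_ge0// ltW.
have h2 : 0 <= (alpha - 1) * (t * ip q q) by rewrite !mulr_ge0//; lra.
have h3 : 0 <= beta * (t ^+ 2 * ip dg q) by rewrite !mulr_ge0// ltW.
have h4 := bound e.
have h5 : beta * - (t ^+ 2 * ip q de) <= beta * (t * `|de| * (1 + W)).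
  by rewrite ler_wpM2l ?(ltW beta0)// bound.
have -> : 2 * t * F + t ^+ 2 * ip g q + t * ip q q
   + t ^+ 2 * ip q (- (alpha / t) *: q - beta *: (dg + de) - (g + e)) =
   2 * (t * F) - (alpha - 1) * (t * ip q q) - beta * (t ^+ 2 * ip dg q)
   + beta * - (t ^+ 2 * ip q de) - t ^+ 2 * ip q e.
  rewrite !(ipDl hip, ipDr hip, ipNr hip, ipZr hip) (ipC hip g q) (ipC hip dg q).
  by field; rewrite gt_eqF.
lra.
Qed.

End Energies.

(** * Estimates along a trajectory *)

Section Trajectory.
Context {R : realType} {H : completeNormedModType R} {ip : H -> H -> R}.
Hypothesis hip : is_inner_product ip.
(** Here q stands for x', and p, g, F are as in the overview. Convexity of f enters through [F_le]
    and [dg_ge0]. *)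
Variables (t0 alpha beta : R) (p q g e dg de : R -> H) (F : R -> R).
Hypothesis t0_gt0 : 0 < t0.
Hypothesis alpha_gt3 : 3 < alpha.
Hypothesis beta_gt0 : 0 < beta.
Hypothesis dp : forall t, t0 <= t -> is_derive t 1 p (q t).
Hypothesis dq : forall t, t0 <= t -> is_derive t 1 q
  (- (alpha / t) *: q t - beta *: (dg t + de t) - (g t + e t)).
Hypothesis dgE : forall t, t0 <= t -> is_derive t 1 g (dg t).
Hypothesis deE : forall t, t0 <= t -> is_derive t 1 e (de t).
Hypothesis dF : forall t, t0 <= t -> is_derive t 1 F (ip (g t) (q t)).
Hypothesis F_ge0 : forall t, t0 <= t -> 0 <= F t.
Hypothesis F_le : forall t, t0 <= t -> F t <= ip (p t) (g t).
Hypothesis dg_ge0 : forall t, t0 <= t -> 0 <= ip (dg t) (q t).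
Hypothesis e_integrable : bounded_primitive t0 (fun t => t * `|e t|).
Hypothesis de_integrable : bounded_primitive t0 (fun t => t * `|de t|).

Let w t := g t + e t.

Let cp t : t0 <= t -> {for t, continuous p}.
Proof. by move=> /dp; exact: is_derive_continuous_at. Qed.
Let cq t : t0 <= t -> {for t, continuous q}.
Proof. by move=> /dq; exact: is_derive_continuous_at. Qed.
Let cg t : t0 <= t -> {for t, continuous g}.
Proof. by move=> /dgE; exact: is_derive_continuous_at. Qed.
Let ce t : t0 <= t -> {for t, continuous e}.
Proof. by move=> /deE; exact: is_derive_continuous_at. Qed.
Let cF t : t0 <= t -> {for t, continuous F}.
Proof. by move=> /dF; exact: is_derive_continuous_at. Qed.
Let csqr (t : R) : {for t, continuous (fun s : R => s ^+ 2)}.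
Proof. exact: is_derive_continuous_at (is_derive_sqrf t). Qed.
Let cw t : t0 <= t -> {for t, continuous w}.
Proof. by move=> tt; apply: cvgD; [exact: cg|exact: ce]. Qed.

Lemma time_gt0 t : t0 <= t -> 0 < t.
Proof. exact: lt_le_trans. Qed.

(* Gronwall for t^2 |e|^2, whose derivative is at most
   (|e| + t |e'|) (1 + t^2 |e|^2). *)
Lemma time_mul_perturbation_bounded :
  exists C, forall t, t0 <= t -> t * `|e t| <= C.
Proof.
pose phi t := t ^+ 2 * ip (e t) (e t).
pose dphi t := 2 * t * ip (e t) (e t) + t ^+ 2 * (ip (de t) (e t) + ip (e t) (de t)).
(* For t >= t0, |e| <= t0^-1 (t |e|), which is integrable by hypothesis. *)
pose k t := t0^-1 * (t * `|e t|) + t * `|de t|.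
have dphiE t : t0 <= t -> is_derive t 1 phi (dphi t).
  move=> tt; apply: is_derive_mulf; first exact: is_derive_sqrf.
  by apply: (is_derive_ip hip); exact: deE.
have phi0 t : t0 <= t -> 0 <= phi t.
  by move=> _; rewrite /phi mulr_ge0 ?sqr_ge0 ?(ip_ge0 hip).
have k0 t : t0 <= t -> 0 <= k t.
  move=> tt; have t_0 := ltW (time_gt0 tt).
  by rewrite /k addr_ge0 ?mulr_ge0// invr_ge0 ltW.
have bk : bounded_primitive t0 k.
  by apply: bounded_primitiveD => //; exact: bounded_primitiveZ.
have hle t : t0 <= t -> dphi t <= k t * (1 + phi t) - cst 0 t.
  move=> tt; rewrite subr0 /dphi /k /phi !(ip_sqr hip) (ipC hip (de t)).
  set n := `|e t|; set m := `|de t|.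
  have t_0 := time_gt0 tt.
  have n0 : 0 <= n by rewrite /n.
  have m0 : 0 <= m by rewrite /m.
  have nm : ip (e t) (de t) <= n * m by exact: ip_le_norm.
  have nle : n <= t0^-1 * (t * n).
    by rewrite mulrA ler_peMl// mulrC ler_pdivlMr// mul1r.
  have : t ^+ 2 * (ip (e t) (de t)) <= t ^+ 2 * (n * m).
    by rewrite ler_wpM2l// sqr_ge0.
  have s0 : 0 <= n + t * m by rewrite addr_ge0// mulr_ge0// ltW.
  have : 2 * (t * n) <= 1 + t ^+ 2 * n ^+ 2.
    by have := sqr_ge0 (t * n - 1); rewrite sqrrB1 exprMn; lra.
  move=> /(ler_wpM2r s0) h1 h2.
  apply: (@le_trans _ _ ((1 + t ^+ 2 * n ^+ 2) * (n + t * m))); first by lra.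
  rewrite [leRHS]mulrC ler_wpM2l ?lerD2r//.
  by rewrite addr_ge0// mulr_ge0// sqr_ge0.
have [[B hB] _] := gronwall_dissipation dphiE phi0 k0 bk
  (fun _ _ => lexx 0) (fun t _ => cvg_cst 0) hle.
exists (1 + B) => t tt; apply: le_1Dsqr.
have := hB _ tt; have := phi0 _ tt; rewrite /phi (ip_sqr hip) exprMn; lra.
Qed.

Lemma lyapunov_dissipation : [/\
  bounded_primitive t0 (fun t => t * ip (p t) (g t)),
  bounded_primitive t0 (fun t => t * ip (q t) (q t)) &
  bounded_primitive t0 (fun t => t ^+ 2 * ip (w t) (w t))].
Proof.
have [C hC] := time_mul_perturbation_bounded.
(* The midpoint of the admissible interval ]2, alpha - 1[, so that mu = (alpha - 3) / 2. *)
pose lam := (alpha + 1) / 2; pose mu := alpha - 1 - lam.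
have lam2 : 2 < lam by have := alpha_gt3; rewrite /lam; lra.
have mu0 : 0 < mu by have := alpha_gt3; rewrite /mu /lam; lra.
(* T collects the lower bounds on t that [lyapunov_derivative_le] requires. *)
pose T := Num.max t0 (Num.max (2 * beta) (Num.max (2 * `|(mu - 1) * beta|)
  (((mu - 1) * beta + lam * beta) / ((lam - 2) / 2)))).
have t0T : t0 <= T by rewrite le_max lexx.
have TP t : T <= t -> [/\ t0 <= t, 2 * beta <= t, `|(mu - 1) * beta| <= t / 2 &
    (mu - 1) * beta + lam * beta <= (lam - 2) / 2 * t].
  rewrite !ge_max => /and4P[h1 h2 h3 h4]; split=> //; first by lra.
  by rewrite [leRHS]mulrC -ler_pdivrMr//; lra.
pose v t := lam *: p t + t *: (q t + beta *: w t).
pose E t := ip (v t) (v t) / 2 + (t ^+ 2 + (mu - 1) * beta * t) * F t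
            + lam * mu / 2 * ip (p t) (p t).
pose dv t := - mu *: q t - (t - beta) *: w t.
pose dE t := ip (v t) (dv t) + (2 * t + (mu - 1) * beta) * F t
  + (t ^+ 2 + (mu - 1) * beta * t) * ip (g t) (q t) + lam * mu * ip (p t) (q t).
(* The equation is used here: beta w in v cancels beta (g + e)' from the acceleration, so neither
   [dg] nor [de] survives, and q gets the coefficient lam + 1 - alpha = - mu. *)
have dvE t : T <= t -> is_derive t 1 v (dv t).
  move=> /TP[tt _ _ _]; have t_0 := time_gt0 tt.
  have dw : is_derive t 1 (fun s => beta *: w s) (beta *: (dg t + de t)).
    by apply: is_derive_scalef; apply: is_derive_addf; [exact: dgE|exact: deE].
  have dz := is_derive_scaling (is_derive_id t 1) (is_derive_addf (dq tt) dw).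
  apply: is_derive_eq (is_derive_addf (is_derive_scalef lam (dp tt)) dz) _.
  have -> : - (alpha / t) *: q t - beta *: (dg t + de t) - (g t + e t) +
      beta *: (dg t + de t) = - (alpha / t) *: q t - w t.
    by rewrite addrAC subrK.
  rewrite scalerBr scalerA mulrN mulrCA divff ?gt_eqF// mulr1 scale1r /dv.
  have -> : - mu = lam + 1 - alpha by rewrite /mu; ring.
  rewrite !scalerBl scalerDl scale1r scaleNr opprB !addrA.
  by rewrite [LHS](ACl (1*2*4*3*5)).
have dEE t : T <= t -> is_derive t 1 E (dE t).
  move=> Tt; have [tt _ _ _] := TP _ Tt.
  have d1 : is_derive t 1 (fun s => ip (v s) (v s) / 2) (ip (v t) (dv t)).
    have -> : (fun s => ip (v s) (v s) / 2) = (fun s => 2^-1 * ip (v s) (v s)).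
      by apply/funext => s; rewrite mulrC.
    apply: is_derive_eq (is_derive_cmulf _ (is_derive_ip hip (dvE _ Tt) (dvE _ Tt))) _.
    by rewrite (ipC hip (dv t)); field.
  have d2 := is_derive_mulf (is_derive_addf (is_derive_sqrf t)
    (is_derive_cmulf ((mu - 1) * beta) (is_derive_id t 1))) (dF tt).
  have d3 := is_derive_cmulf (lam * mu / 2) (is_derive_ip hip (dp tt) (dp tt)).
  apply: is_derive_eq (is_derive_addf (is_derive_addf d1 d2) d3) _.
  by rewrite /dE (ipC hip (q t) (p t)); field.
have E0 t : T <= t -> 0 <= E t.
  move=> /TP[tt h1 /[!ler_norml]/andP[h2 h3] h4]; have t_0 := time_gt0 tt.
  rewrite /E !addr_ge0//.
  - by rewrite divr_ge0// ip_ge0.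
  - rewrite mulr_ge0 ?F_ge0// expr2 -mulrDl mulr_ge0 ?(ltW t_0)//; lra.
  - by rewrite mulr_ge0 ?ip_ge0// divr_ge0// mulr_ge0//; lra.
pose kappa := 3 / 2 + (1 + lam * mu / 2) / 2 + 9 / 4 * beta * C.
pose d t := (lam - 2) / 2 * (t * ip (p t) (g t)) + mu * (t * ip (q t) (q t))
        + beta / 4 * (t ^+ 2 * ip (w t) (w t)).
have kappa0 : 0 <= kappa.
  have C0 : 0 <= C by rewrite (le_trans _ (hC _ (lexx t0)))// mulr_ge0// ltW.
  have lm0 : 0 <= lam * mu by rewrite mulr_ge0//; lra.
  have : 0 <= beta * C by rewrite mulr_ge0// ltW.
  by rewrite /kappa; lra.
have k0 t : T <= t -> 0 <= kappa * (t * `|e t|).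
  by move=> /TP[tt _ _ _]; rewrite !mulr_ge0// ltW// time_gt0.
have c1 t : t0 <= t -> {for t, continuous (fun s : R => s * ip (p s) (g s))}.
  by move=> tt; apply: cvgM; [exact: cvg_id|apply: (cvg_ip hip); [exact: cp|exact: cg]].
have c2 t : t0 <= t -> {for t, continuous (fun s : R => s * ip (q s) (q s))}.
  by move=> tt; apply: cvgM; [exact: cvg_id|apply: (cvg_ip hip); exact: cq].
have c3 t : t0 <= t -> {for t, continuous (fun s : R => s ^+ 2 * ip (w s) (w s))}.
  by move=> tt; apply: cvgM; [exact: csqr|apply: (cvg_ip hip); exact: cw].
have s1 t : t0 <= t -> 0 <= t * ip (p t) (g t).
  move=> tt; rewrite mulr_ge0 ?(ltW (time_gt0 tt))//.
  exact: le_trans (F_ge0 tt) (F_le tt).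
have s2 t : t0 <= t -> 0 <= t * ip (q t) (q t).
  by move=> tt; rewrite mulr_ge0 ?(ltW (time_gt0 tt))// ip_ge0.
have s3 t : 0 <= t ^+ 2 * ip (w t) (w t) by rewrite mulr_ge0 ?sqr_ge0// ip_ge0.
have a1 : 0 < (lam - 2) / 2 by lra.
have a3 : 0 < beta / 4 by rewrite divr_gt0.
have d0 t : T <= t -> 0 <= d t.
  move=> /TP[tt _ _ _].
  by rewrite !addr_ge0// mulr_ge0 ?s1 ?s2 ?s3// ltW.
have cd t : T <= t -> {for t, continuous d}.
  move=> /TP[tt _ _ _]; apply: cvgD; first apply: cvgD.
  - by apply: cvgM; [exact: cvg_cst|exact: c1].
  - by apply: cvgM; [exact: cvg_cst|exact: c2].
  - by apply: cvgM; [exact: cvg_cst|exact: c3].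
have hle t : T <= t -> dE t <= kappa * (t * `|e t|) * (1 + E t) - d t.
  move=> /TP[tt h1 h2 h3].
  by apply: (lyapunov_derivative_le hip) => //; [exact: F_ge0|exact: F_le|exact: hC].
have bk : bounded_primitive T (fun t => kappa * (t * `|e t|)).
  by apply: bounded_primitiveZ; exact: bounded_primitive_tail e_integrable.
have [_ bd] := gronwall_dissipation dEE E0 k0 bk d0 cd hle.
(* Each of the three nonnegative summands of d is dominated by d, hence has a bounded primitive from
   T on, and then from t0 on. *)
have sub (c : R) (k : R -> R) : 0 < c ->
    (forall t, t0 <= t -> {for t, continuous k}) ->
    (forall t, t0 <= t -> 0 <= k t) ->
    (forall t, t0 <= t -> c * k t <= d t) -> bounded_primitive t0 k.
  move=> c0 ck k_0 kd; apply: (bounded_primitive_extend t0T) => //.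
  apply: bounded_primitive_le (bounded_primitiveZ c^-1 bd) => t /TP[tt _ _ _].
    exact: ck.
  by rewrite k_0//= mulrC ler_pdivlMr// mulrC kd.
split => //.
- apply: (sub _ _ a1) => // t tt; rewrite /d -addrA lerDl.
  by rewrite addr_ge0// mulr_ge0 ?s2// ltW.
- apply: (sub _ _ mu0) => // t tt; rewrite /d addrAC lerDr.
  by rewrite addr_ge0// mulr_ge0 ?s1// ltW.
- apply: (sub _ _ a3) => // t tt; rewrite /d lerDr.
  by rewrite addr_ge0// mulr_ge0 ?s1 ?s2// ltW.
Qed.

Lemma trajectory_bounded_primitives : [/\
  bounded_primitive t0 (fun t => t * ip (p t) (g t)),
  bounded_primitive t0 (fun t => t * F t),
  bounded_primitive t0 (fun t => t * ip (q t) (q t)),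
  bounded_primitive t0 (fun t => t ^+ 2 * ip (g t) (g t)) &
  (fun t => t ^+ 2 * F t + t ^+ 2 * ip (q t) (q t) / 2) @ +oo --> 0].
Proof.
have [bpg bq bw] := lyapunov_dissipation; have [C hC] := time_mul_perturbation_bounded.
have bF : bounded_primitive t0 (fun t => t * F t).
  apply: bounded_primitive_le bpg => t tt.
    by apply: cvgM; [exact: cvg_id|exact: cF].
  have t_0 := ltW (time_gt0 tt).
  by rewrite mulr_ge0 ?F_ge0//= ler_wpM2l ?F_le.
pose W t := t ^+ 2 * F t + t ^+ 2 * ip (q t) (q t) / 2.
have W_cvg : W @ +oo --> 0.
  pose dW t := 2 * t * F t + t ^+ 2 * ip (g t) (q t) + t * ip (q t) (q t)
   + t ^+ 2 * ip (q t) (- (alpha / t) *: q t - beta *: (dg t + de t) - (g t + e t)).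
  have dWE t : t0 <= t -> is_derive t 1 W (dW t).
    move=> tt; have d1 := is_derive_mulf (is_derive_sqrf t) (dF tt).
    have d2 := is_derive_mulf (is_derive_sqrf t) (is_derive_ip hip (dq tt) (dq tt)).
    have d3 := is_derive_mulf d2 (is_derive_cst (2^-1 : R^o) t 1).
    apply: is_derive_eq (is_derive_addf d1 d3) _.
    by rewrite /dW (ipC hip (_ - _) (q t)) /=; field.
  have W0 t : t0 <= t -> 0 <= W t.
    move=> tt; apply: addr_ge0; first by rewrite mulr_ge0 ?sqr_ge0// F_ge0.
    by rewrite divr_ge0// mulr_ge0 ?sqr_ge0// (ip_ge0 hip).
  pose k t := 2 * (t * F t) + t * `|e t| + beta * (t * `|de t|).
  have bk : bounded_primitive t0 k.
    apply: bounded_primitiveD; last exact: bounded_primitiveZ.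
    by apply: bounded_primitiveD => //; exact: bounded_primitiveZ.
  have k0 t : t0 <= t -> 0 <= k t.
    move=> tt; have t_0 := ltW (time_gt0 tt).
    by rewrite /k !addr_ge0 ?mulr_ge0 ?F_ge0// ltW.
  have hle t : t0 <= t -> dW t <= k t * (1 + W t).
    move=> tt; apply: (kinetic_derivative_le hip) => //.
    - by apply: lt_trans alpha_gt3; rewrite ltr1n.
    - exact: time_gt0.
    - exact: F_ge0.
    - exact: dg_ge0.
  have hle0 t : t0 <= t -> dW t <= k t * (1 + W t) - cst 0 t.
    by move=> tt; rewrite subr0; exact: hle.
  (* A first use of the inequality bounds W by some B; the derivative of W is then at most (1 + B)
     k, which is integrable. *)
  have [[B hB] _] := gronwall_dissipation dWE W0 k0 bk
    (fun _ _ => lexx 0) (fun t _ => cvg_cst 0) hle0.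
  apply: (nonneg_log_integrable_cvg0 t0_gt0 dWE W0 (k := fun t => (1 + B) * k t)).
  - move=> t tt; rewrite mulr_ge0 ?k0// addr_ge0// (le_trans (W0 _ tt))//.
    exact: hB.
  - exact: bounded_primitiveZ.
  - move=> t tt; rewrite (le_trans (hle _ tt))// mulrC ler_wpM2r ?k0//.
    by rewrite lerD2l hB.
  (* W / t = t F + t |q|^2 / 2, a sum of two quantities already known to be integrable. *)
  - apply: bounded_primitive_eq (bounded_primitiveD bF (bounded_primitiveZ 2^-1 bq)).
    by move=> t tt; rewrite /W; field; rewrite gt_eqF// time_gt0.
split=> //.
(* Since g = w - e, t^2 |g|^2 <= 2 t^2 |w|^2 + 2 t^2 |e|^2, and t^2 |e|^2 <= C t |e|. *)
have := bounded_primitiveD (bounded_primitiveZ 2 bw) (bounded_primitiveZ (2 * C) e_integrable).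
apply: bounded_primitive_le => t tt.
  apply: cvgM; first exact: csqr.
  by apply: (cvg_ip hip); exact: cg.
have t_0 := time_gt0 tt.
rewrite mulr_ge0 ?sqr_ge0 ?(ip_ge0 hip)//=.
have gwe : ip (g t) (g t) <= 2 * ip (w t) (w t) + 2 * `|e t| ^+ 2.
  (* Parallelogram law: 2 |w|^2 + 2 |e|^2 - |w - e|^2 = |w + e|^2. *)
  have := ip_ge0 hip (w t + e t); rewrite /w -(ip_sqr hip).
  by rewrite !(ipDl hip, ipDr hip) (ipC hip (e t) (g t)); lra.
have := ler_wpM2l (sqr_ge0 t) gwe; move=> /le_trans; apply.
have te0 : 0 <= t * `|e t| by rewrite mulr_ge0// ltW.
have := ler_wpM2r te0 (hC _ tt); lra.
Qed.

(** Both summands of the energy W are nonnegative, so each tends to 0 with W; the integrals come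
    from the bounded primitives. *)
Lemma trajectory_estimates : [/\
  (fun t => t ^+ 2 * F t) @ +oo --> 0,
  (\int[lebesgue_measure]_(t in `[t0, +oo[) (t ^+ 2 * `|g t| ^+ 2)%:E < +oo)%E,
  (\int[lebesgue_measure]_(t in `[t0, +oo[) (t * F t)%:E < +oo)%E,
  (\int[lebesgue_measure]_(t in `[t0, +oo[) (t * ip (g t) (p t))%:E < +oo)%E &
  (\int[lebesgue_measure]_(t in `[t0, +oo[) (t * `|q t| ^+ 2)%:E < +oo)%E /\
  (fun t => t * `|q t|) @ +oo --> 0].
Proof.
have [bpg bF bq bg W0] := trajectory_bounded_primitives.
have t_ge0 t : t0 <= t -> 0 <= t by move=> tt; exact: ltW (time_gt0 tt).
split; [| | | |split].
- apply/cvgr0Pnorm_le => eps eps0; near=> t.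
  have tt : t0 <= t by near: t; apply: nbhs_pinfty_ge; exact: num_real.
  have F0 : 0 <= t ^+ 2 * F t by rewrite mulr_ge0 ?sqr_ge0 ?F_ge0.
  have q0 : 0 <= t ^+ 2 * ip (q t) (q t) / 2.
    by rewrite divr_ge0// mulr_ge0 ?sqr_ge0 ?(ip_ge0 hip).
  rewrite ger0_norm//; apply: (@le_trans _ _ (t ^+ 2 * F t + t ^+ 2 * ip (q t) (q t) / 2)).
    by rewrite lerDl.
  rewrite -[leLHS]ger0_norm ?addr_ge0//.
  by near: t; move/cvgr0Pnorm_le : W0; exact.
- under eq_integral do rewrite -(ip_sqr hip).
  apply: bounded_primitive_integral_lty bg => t tt.
    by apply: cvgM; [exact: csqr|apply: (cvg_ip hip); exact: cg].
  by rewrite mulr_ge0 ?sqr_ge0 ?(ip_ge0 hip).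
- apply: bounded_primitive_integral_lty bF => t tt.
    by apply: cvgM; [exact: cvg_id|exact: cF].
  by rewrite mulr_ge0 ?(t_ge0 _ tt) ?F_ge0.
- under eq_integral do rewrite (ipC hip).
  apply: bounded_primitive_integral_lty bpg => t tt.
    by apply: cvgM; [exact: cvg_id|apply: (cvg_ip hip); [exact: cp|exact: cg]].
  by rewrite mulr_ge0 ?(t_ge0 _ tt)//; exact: le_trans (F_ge0 tt) (F_le tt).
- under eq_integral do rewrite -(ip_sqr hip).
  apply: bounded_primitive_integral_lty bq => t tt.
    by apply: cvgM; [exact: cvg_id|apply: (cvg_ip hip); exact: cq].
  by rewrite mulr_ge0 ?(t_ge0 _ tt) ?(ip_ge0 hip).
- apply/cvgr0Pnorm_le => eps eps0; near=> t.
  have tt : t0 <= t by near: t; apply: nbhs_pinfty_ge; exact: num_real.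
  have F0 : 0 <= t ^+ 2 * F t by rewrite mulr_ge0 ?sqr_ge0 ?F_ge0.
  have q0 : 0 <= t * `|q t| by rewrite mulr_ge0 ?(t_ge0 _ tt).
  (* The tolerance eps^2 / 2 matches the factor 1 / 2 of the kinetic term: it yields (t |q|)^2 <=
     eps^2. *)
  have : `|t ^+ 2 * F t + t ^+ 2 * ip (q t) (q t) / 2| <= eps ^+ 2 / 2.
    by near: t; move/cvgr0Pnorm_le : W0; apply; rewrite divr_gt0// exprn_gt0.
  move=> /(le_trans (ler_norm _)); rewrite (ip_sqr hip) -exprMn => h.
  rewrite ger0_norm// -ler_sqr ?nnegrE ?(ltW eps0)//; lra.
Unshelve. all: end_near. Qed.

End Trajectory.

(** * Application to the differential equation *)

Lemma inf_range_min (R : realType) (T : Type) (f : T -> R) xs :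
  (forall y, f xs <= f y) -> inf (range f) = f xs.
Proof.
move=> fxs; apply/eqP; rewrite eq_le; apply/andP; split.
  by apply: ge_inf; [exists (f xs) => _ [y _ <-]|exists xs].
by apply: lb_le_inf; [exists (f xs), xs|move=> _ [y _ <-]].
Qed.

Theorem theorem5 (R : realType) (H : completeNormedModType R)
  (ip : H -> H -> R) (t0 : R) (f : H -> R) (gradf : H -> H)
  (e : R -> H) (alpha beta : R) (x : R -> H) :
  is_inner_product ip ->
  0 < t0 ->
  convex_fun f ->
  C2_fun ip f gradf ->
  (exists xs : H, forall y, f xs <= f y) ->
  (* e is C^1 on [t0, +oo[ *)
  (forall t, t0 <= t -> derivable e t 1) ->
  (forall t, t0 <= t -> {for t, continuous (derive1 e)}) ->
  (\int[lebesgue_measure]_(t in `[t0, +oo[) (t * `|e t|)%:E < +oo)%E ->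
  (\int[lebesgue_measure]_(t in `[t0, +oo[) (t * `|derive1 e t|)%:E < +oo)%E ->
  3 < alpha -> 0 < beta ->
  (* x is a (classical, C^2) solution trajectory on [t0, +oo[ *)
  (forall t, t0 <= t -> derivable x t 1) ->
  (forall t, t0 <= t -> derivable (derive1 x) t 1) ->
  (forall t, t0 <= t -> {for t, continuous (derive1n 2 x)}) ->
  (forall t, t0 <= t -> derivable (fun s => gradf (x s) + e s) t 1) ->
  (forall t, t0 <= t ->
     derive1n 2 x t + (alpha / t) *: derive1 x t
     + beta *: derive1 (fun s => gradf (x s) + e s) t
     + (gradf (x t) + e t) = 0) ->
  (* (i) *)
      (fun t => t ^+ 2 * (f (x t) - inf (range f))) @ +oo --> 0 /\
      (* (ii) *)
      (\int[lebesgue_measure]_(t in `[t0, +oo[) (t ^+ 2 * `|gradf (x t)| ^+ 2)%:E < +oo)%E /\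
      (* (iii) *)
      (\int[lebesgue_measure]_(t in `[t0, +oo[) (t * (f (x t) - inf (range f)))%:E < +oo)%E /\
      (* (iv) *)
      (forall xs : H, (forall y, f xs <= f y) ->
        (\int[lebesgue_measure]_(t in `[t0, +oo[) (t * ip (gradf (x t)) (x t - xs))%:E < +oo)%E) /\
      (* (v) *)
      (\int[lebesgue_measure]_(t in `[t0, +oo[) (t * `|derive1 x t| ^+ 2)%:E < +oo)%E /\
      (* (vi) *)
      (fun t => t * `|derive1 x t|) @ +oo --> 0.
Proof.
move=> hip t0_gt0 cf [gf _] [xm xm_min] de ce' ie ide alpha3 beta0 dx ddx _ dw ode.
(* The derivative of the gradient along x is recovered as the derivative of the sum with e minus
   that of e. *)
pose dg t := derive1 (fun s => gradf (x s) + e s) t - derive1 e t.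
have dxE t : t0 <= t -> is_derive t 1 x (derive1 x t).
  by move=> /dx h; rewrite derive1E; exact: derivableP.
have deE t : t0 <= t -> is_derive t 1 e (derive1 e t).
  by move=> /de h; rewrite derive1E; exact: derivableP.
have dgE t : t0 <= t -> is_derive t 1 (fun s => gradf (x s)) (dg t).
  move=> tt; have dwt : is_derive t 1 (fun s => gradf (x s) + e s)
      (derive1 (fun s => gradf (x s) + e s) t).
    by rewrite derive1E; exact: derivableP (dw _ tt).
  have := is_deriveB dwt (deE _ tt).
  rewrite [X in is_derive _ _ X](_ : _ = fun s => gradf (x s))//.
  by apply/funext => s; rewrite /= !fctE addrK.
(* The differential equation solved for x''. *)
have ddxE t : t0 <= t -> is_derive t 1 (derive1 x) (- (alpha / t) *: derive1 x t
    - beta *: (dg t + derive1 e t) - (gradf (x t) + e t)).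
  move=> tt; have : is_derive t 1 (derive1 x) (derive1 (derive1 x) t).
    by rewrite derive1E; exact: derivableP (ddx _ tt).
  move=> /is_derive_eq; apply; rewrite /dg subrK scaleNr.
  have := ode _ tt; rewrite derive1nS derive1n1.
  set a := derive1 (derive1 x) t; set b := _ *: derive1 x t; set c := beta *: _.
  by move=> /eqP; rewrite addr_eq0 => /eqP <-; rewrite -opprD -addrA [RHS]addrC addrK.
have time_ge0 t : t0 <= t -> 0 <= t by move=> /(lt_le_trans t0_gt0)/ltW.
have weighted_integrable (u : R -> H) : (forall t, t0 <= t -> {for t, continuous u}) ->
    (\int[lebesgue_measure]_(t in `[t0, +oo[) (t * `|u t|)%:E < +oo)%E ->
    bounded_primitive t0 (fun t => t * `|u t|).
  move=> cu; apply: integral_lty_bounded_primitive => t tt.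
    by apply: cvgM; [exact: cvg_id|apply: cvg_norm; exact: cu].
  by rewrite mulr_ge0// time_ge0.
have est xs (xs_min : forall y, f xs <= f y) :=
  @trajectory_estimates R H ip hip t0 alpha beta (fun t => x t - xs) (derive1 x)
    (fun t => gradf (x t)) e dg (derive1 e) (fun t => f (x t) - inf (range f))
    t0_gt0 alpha3 beta0.
have {}est xs : (forall y, f xs <= f y) -> [/\
    (fun t => t ^+ 2 * (f (x t) - inf (range f))) @ +oo --> 0,
    (\int[lebesgue_measure]_(t in `[t0, +oo[) (t ^+ 2 * `|gradf (x t)| ^+ 2)%:E < +oo)%E,
    (\int[lebesgue_measure]_(t in `[t0, +oo[) (t * (f (x t) - inf (range f)))%:E < +oo)%E,
    (\int[lebesgue_measure]_(t in `[t0, +oo[)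
      (t * ip (gradf (x t)) (x t - xs))%:E < +oo)%E &
    (\int[lebesgue_measure]_(t in `[t0, +oo[) (t * `|derive1 x t| ^+ 2)%:E < +oo)%E /\
    (fun t => t * `|derive1 x t|) @ +oo --> 0].
  move=> xs_min; apply: (est xs xs_min _ ddxE dgE deE) => [t tt|t tt|t tt|t tt|t tt||].
  - rewrite -[derive1 x t]subr0.
    exact: is_deriveB (dxE _ tt) (is_derive_cst xs t 1).
  - have dfx := is_gradient_chain gf (dxE _ tt).
    apply: is_derive_eq (is_derive_addf dfx (is_derive_cst (- inf (range f) : R^o) t 1)) _.
    by rewrite addr0.
  - by rewrite subr_ge0 (inf_range_min xs_min).
  (* The gradient inequality at x(t) in the direction of xs gives f(x(t)) - f(xs) <= <g, x(t) -
     xs>. *)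
  - rewrite (inf_range_min xs_min) (ipC hip).
    have := convex_gradient_le (x t) xs cf gf.
    by rewrite -opprB (ipNr hip); lra.
  - apply: (derive_ip_ge0 hip (dgE _ tt) (dxE _ tt)) => s.
    exact: (convex_gradient_monotone hip _ _ cf gf).
  - by apply: weighted_integrable ie => t tt; exact: is_derive_continuous_at (deE _ tt).
  - exact: weighted_integrable ide.
(* Only (iv) depends on the minimizer; the other claims are read off from the single minimizer
   [xm]. *)
have [h1 h2 h3 _ [h5 h6]] := est _ xm_min.
by do !split => //; move=> xs /est[].
Qed.
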